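(* Let $D = 2^n$, let $|\psi\rangle, |\phi\rangle \in \mathbb{C}^D$ be quantum states (unit vectors), and let $I \subset \{0,\ldots,D-1\}$ be such that $P_I|\psi\rangle \neq 0$ and $P_I|\phi\rangle \neq 0$. Let $|\psi_I\rangle$ and $|\phi_I\rangle$ be the truncations of $|\psi\rangle$ and $|\phi\rangle$ to the coordinates in $I$. Then $$F(|\psi\rangle, |\phi_I\rangle) = F(|\psi\rangle, |\psi_I\rangle)\cdot F(|\psi_I\rangle, |\phi_I\rangle).$$
   Context: A quantum state on $n$ qubits is a vector of unit $\ell_2$-norm in $\mathbb{C}^D$, $D = 2^n$, with standard orthonormal basis $|0\rangle,\ldots,|D-1\rangle$. The fidelity of two quantum states is $F(|\psi\rangle,|\phi\rangle) = |\langle\psi|\phi\rangle|^2$, where $\langle\psi|\phi\rangle = (\psi^* )^{\mathrm T}\phi$ is the standard Hermitian inner product (conjugate-linear in the first argument). For $I \subset \{0,\ldots,D-1\}$ let $P_I = \sum_{i\in I} |i\rangle\langle i|$ be the orthogonal projection onto the coordinates in $I$. The truncation of a state $|\psi\rangle$ with $P_I|\psi\rangle\neq 0$ is $$|\psi_I\rangle = \frac{P_I|\psi\rangle}{\|P_I|\psi\rangle\|_{\ell_2}}.$$ *)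

(* Defs.v *)
From mathcomp Require Import all_boot all_order all_algebra.
From mathcomp Require Import reals.
From mathcomp Require Import complex.

Set Implicit Arguments.
Unset Strict Implicit.
Unset Printing Implicit Defensive.

Import GRing.Theory Num.Theory.

Local Open Scope ring_scope.
Local Open Scope complex_scope.
Local Open Scope sesquilinear_scope.

Import ComplexField.Normc.

Definition ket (R : realType) (D : nat) (i : 'I_D) : 'cV[R[i]]_D :=
  delta_mx i 0.

(* [_ ^t*] is the conjugate transpose, so this is conjugate-linear in the
   first argument; spectral.v's [dotmx] is for row vectors and is
   conjugate-linear in the second one. *)
Definition braket (R : realType) (D : nat) (psi phi : 'cV[R[i]]_D) : R[i] :=
  (psi ^t* *m phi) 0 0.

(* [normc : R[i] -> R] is the real-valued complex modulus; the generic norm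
   [`|_|] on R[i] takes its values in R[i]. *)
Definition l2norm (R : realType) (D : nat) (psi : 'cV[R[i]]_D) : R :=
  Num.sqrt (\sum_(i < D) normc (psi i 0) ^+ 2).

Definition quantum_state (R : realType) (D : nat) (psi : 'cV[R[i]]_D) : Prop :=
  l2norm psi = 1.

Definition fidelity (R : realType) (D : nat) (psi phi : 'cV[R[i]]_D) : R :=
  normc (braket psi phi) ^+ 2.

Definition proj (R : realType) (D : nat) (I : {set 'I_D}) : 'M[R[i]]_D :=
  \sum_(i in I) ket R i *m (ket R i) ^t*.

(* Since 0^-1 = 0, this is the zero vector when proj R I *m psi = 0. *)
Definition truncation (R : realType) (D : nat) (I : {set 'I_D})
    (psi : 'cV[R[i]]_D) : 'cV[R[i]]_D :=
  ((l2norm (proj R I *m psi))^-1)%:C *: (proj R I *m psi).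

(* Main.v *)
(* Write P for the coordinate projection and a = ||P psi||, b = ||P phi||.
   Since P is a self-adjoint idempotent, <psi|P phi> = <P psi|P phi>, so
   <psi|phi_I> = <P psi|P phi> / b, <psi|psi_I> = a^2 / a = a and
   <psi_I|phi_I> = <P psi|P phi> / (a b). *)
Require Import Defs.
From mathcomp Require Import all_boot all_order all_algebra.
From mathcomp Require Import reals.
From mathcomp Require Import complex.
From mathcomp Require Import ring.

Import Order.TTheory GRing.Theory Num.Theory.
Import ComplexField.Normc.

Local Open Scope ring_scope.
Local Open Scope complex_scope.

Lemma braketE (R : realType) (D : nat) (psi phi : 'cV[R[i]]_D) :
  braket psi phi = \sum_(i < D) (psi i 0)^* * phi i 0.
Proof. by rewrite /braket mxE; apply: eq_bigr => i _; rewrite !mxE. Qed.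

Lemma braketZr (R : realType) (D : nat) (c : R[i]) (psi phi : 'cV[R[i]]_D) :
  braket psi (c *: phi) = c * braket psi phi.
Proof. by rewrite /braket -scalemxAr mxE. Qed.

Lemma braketZl (R : realType) (D : nat) (c : R[i]) (psi phi : 'cV[R[i]]_D) :
  braket (c *: psi) phi = c^* * braket psi phi.
Proof.
by rewrite !braketE mulr_sumr; apply: eq_bigr => i _; rewrite mxE rmorphM mulrA.
Qed.

(** Each rank-one term |i><i| sends [psi] to a vector supported at i with entry [psi i 0], so row j
    only sees i = j. *)
Lemma proj_mulE (R : realType) (D : nat) (I : {set 'I_D}) (psi : 'cV[R[i]]_D) j :
  (proj R I *m psi) j 0 = if j \in I then psi j 0 else 0.
Proof.
rewrite /proj mulmx_suml summxE (eq_bigr (fun i => (j == i)%:R * psi i 0)).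
  case: ifPn => jI.
    rewrite (bigD1 j) //= eqxx mul1r big1 ?addr0 // => i /andP[_ ij].
    by rewrite eq_sym (negbTE ij) mul0r.
  rewrite big1 // => i iI; case: eqP => [ji|_]; last by rewrite mul0r.
  by rewrite ji iI in jI.
move=> i _; rewrite -mulmxA mxE big_ord1 mxE andbT; congr (_ * _).
rewrite mxE (bigD1 i) //= big1 => [|k ki]; rewrite !mxE ?eqxx ?(negbTE ki) /=.
  by rewrite conjC1 mul1r addr0.
by rewrite conjC0 mul0r.
Qed.

(** Termwise: inside [I] both projections change nothing, and outside [I] the zero entry of P phi
    kills the term, whatever stands on the left. *)
Lemma braket_proj (R : realType) (D : nat) (I : {set 'I_D})
    (psi phi : 'cV[R[i]]_D) :
  braket psi (proj R I *m phi) = braket (proj R I *m psi) (proj R I *m phi).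
Proof.
rewrite !braketE; apply: eq_bigr => i _; rewrite !proj_mulE.
by case: ifP => // _; rewrite !mulr0.
Qed.

Lemma braket_self (R : realType) (D : nat) (psi : 'cV[R[i]]_D) :
  braket psi psi = (l2norm psi ^+ 2)%:C.
Proof.
rewrite sqr_sqrtr; last by apply: sumr_ge0 => i _; exact: sqr_ge0.
rewrite braketE rmorph_sum; apply: eq_bigr => i _.
(* With the entry written x + iy, what remains is (x - iy)(x + iy) = x^2 + y^2, checked on real and
   imaginary parts. *)
case: (psi i 0) => x y; rewrite /= sqr_sqrtr ?addr_ge0 ?sqr_ge0 //.
by apply/eqP; rewrite eq_complex /=; apply/andP; split; apply/eqP; ring.
Qed.

Lemma l2norm_eq0 (R : realType) (D : nat) (psi : 'cV[R[i]]_D) :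
  l2norm psi = 0 -> psi = 0.
Proof.
(* [Num.sqrt] is also 0 on negative numbers, so this only gives that the sum is at most 0; its
   nonnegative terms then force equality. *)
move/eqP; rewrite sqrtr_eq0 => le0; apply/matrixP => i j; rewrite ord1 mxE.
have sum0 : \sum_(k < D) normc (psi k 0) ^+ 2 = 0.
  by apply/le_anti; rewrite le0 sumr_ge0 // => k _; exact: sqr_ge0.
have /eqP := psumr_eq0P (fun k _ => sqr_ge0 (normc (psi k 0))) sum0 (i := i) isT.
by rewrite sqrf_eq0 => /eqP /eq0_normc.
Qed.

Lemma normc_real_sqr (R : realType) (x : R) : normc x%:C ^+ 2 = x ^+ 2.
Proof. by rewrite /= expr0n addr0 sqr_sqrtr // sqr_ge0. Qed.

Lemma fidelityZr (R : realType) (D : nat) (a : R) (psi phi : 'cV[R[i]]_D) :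
  fidelity psi (a%:C *: phi) = a ^+ 2 * fidelity psi phi.
Proof. by rewrite /fidelity braketZr normcM exprMn normc_real_sqr. Qed.

Lemma fidelityZl (R : realType) (D : nat) (a : R) (psi phi : 'cV[R[i]]_D) :
  fidelity (a%:C *: psi) phi = a ^+ 2 * fidelity psi phi.
Proof.
have conj_a : Num.conj (a%:C : R[i]) = a%:C by exact: conjc_real.
by rewrite /fidelity braketZl conj_a normcM exprMn normc_real_sqr.
Qed.

Lemma fidelity_self (R : realType) (D : nat) (psi : 'cV[R[i]]_D) :
  fidelity psi psi = l2norm psi ^+ 4.
Proof. by rewrite /fidelity braket_self normc_real_sqr -exprM. Qed.

Lemma fidelity_proj (R : realType) (D : nat) (I : {set 'I_D})
    (psi phi : 'cV[R[i]]_D) :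
  fidelity psi (proj R I *m phi) = fidelity (proj R I *m psi) (proj R I *m phi).
Proof. by rewrite /fidelity braket_proj. Qed.

Theorem lemma1 (R : realType) (n : nat) (psi phi : 'cV[R[i]]_(2 ^ n))
    (I : {set 'I_(2 ^ n)})
    (psi_state : quantum_state psi) (phi_state : quantum_state phi)
    (psiI_neq0 : proj R I *m psi <> 0) (phiI_neq0 : proj R I *m phi <> 0) :
  fidelity psi (truncation I phi) =
  fidelity psi (truncation I psi) * fidelity (truncation I psi) (truncation I phi).
Proof.
have a_neq0 : l2norm (proj R I *m psi) != 0.
  by apply/eqP => /l2norm_eq0.
(* Fixing [psi] in [fidelity_proj] keeps the repeated rewrite from projecting P psi again and
   again. *)
rewrite /truncation !fidelityZr fidelityZl !(fidelity_proj _ _ I psi) fidelity_self.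
(* Here a = ||P psi||, b' = 1 / ||P phi|| and F is the fidelity of P psi and P phi. Both sides carry
   b'^2 F, and the other factors on the right are a^-2 a^4 a^-2 = 1. *)
move: (l2norm _) (l2norm _)^-1 (fidelity _ _) a_neq0 => a b' F a_neq0.
by field.
Qed.
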